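(* Let $\mathfrak g$ be a Lie algebra over $\mathbf k$, $D\in\mathrm{Der}(\mathfrak g)$ a derivation, $\lambda\in\mathbf k$ and $x\in\mathfrak g$. Then $$(\lambda\,\mathrm{ad}\,x+D)^n(x)=\sum_{i=1}^{n}\lambda^{i-1}\sum_{\alpha\vDash n+1,\ \ell(\alpha)=i}C_\alpha D^\alpha(x),\qquad n=1,\dots,p-1,$$ where $D^\alpha(x):=[D^{\alpha_1-1}(x),[\cdots,[D^{\alpha_{i-1}-1}(x),D^{\alpha_i-1}(x)]\cdots]]$ for $\alpha=(\alpha_1,\dots,\alpha_i)\vDash n+1$.
   Context: $\mathbf k$ is an algebraically closed field of prime characteristic $p$. $\alpha\vDash n$ means that $\alpha=(\alpha_1,\dots,\alpha_r)$ is a composition of $n$ (a tuple of positive integers with sum $n$), with length $\ell(\alpha)=r$, and $C_\alpha=\prod_{k=1}^r\binom{\alpha_1+\cdots+\alpha_k-1}{\alpha_k-1}$; equivalently $C_\alpha$ is the number of set partitions $(B_1,\dots,B_r)$ of $\{1,\dots,n\}$ with $\max B_1<\cdots<\max B_r$ and $|B_k|=\alpha_k$. For $i=1$, $D^{(n+1)}(x)=D^n(x)$; $\lambda^0=1$. *)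

(* Defs.v *)
From HB Require Import structures.
From mathcomp Require Import all_boot all_order all_algebra.

Set Implicit Arguments.
Unset Strict Implicit.
Unset Printing Implicit Defensive.

Import GRing.Theory.
Local Open Scope ring_scope.

HB.mixin Record Lmodule_isLieAlgebra (R : comPzRingType) (V : Type)
    of GRing.Lmodule R V := {
  lie : V -> V -> V;
  lie_linearl : forall y : V, linear (fun x => lie x y);
  lie_linearr : forall x : V, linear (lie x);
  liexx : forall x : V, lie x x = 0;
  lie_jacobi : forall x y z : V,
    lie x (lie y z) + lie y (lie z x) + lie z (lie x y) = 0
}.

#[short(type="lieAlgType")]
HB.structure Definition LieAlgebra (R : comPzRingType) :=
  { V of GRing.Lmodule R V & Lmodule_isLieAlgebra R V }.

Definition ad (R : comPzRingType) (g : lieAlgType R) (x : g) : g -> g :=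
  fun y => lie x y.

Definition derivation (R : comPzRingType) (g : lieAlgType R)
    (D : {linear g -> g}) : Prop :=
  forall x y : g, D (lie x y) = lie (D x) y + lie x (D y).

Definition is_composition (n : nat) (a : seq nat) : bool :=
  all (leq 1) a && (sumn a == n).

(* With 0-based k, take k.+1 a lists the first k + 1 parts of a. *)
Definition comp_coef (a : seq nat) : nat :=
  (\prod_(k < size a) 'C((sumn (take k.+1 a)).-1, (nth 0 a k).-1))%N.

(* The value on [::] is junk: compositions of a positive integer are
   nonempty. *)
Fixpoint comp_lie (R : comPzRingType) (g : lieAlgType R) (D : g -> g) (x : g)
    (a : seq nat) : g :=
  match a with
  | [::] => 0
  | [:: m] => iter m.-1 D x
  | m :: s => lie (iter m.-1 D x) (comp_lie D x s)
  end.

(* Main.v *)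
Require Import Defs.
From HB Require Import structures.
From mathcomp Require Import all_boot all_order all_algebra.

Set Implicit Arguments.
Unset Strict Implicit.
Unset Printing Implicit Defensive.

Import GRing.Theory.
Local Open Scope ring_scope.

(** Applying [lambda ad x + D] to [D^a(x)] either prepends a part 1 to [a]
    (with a factor [lambda]) or, by the Leibniz rule, increments one part of
    [a]. Hence the [n]-th iterate is the sum of [lambda^(size a - 1) D^a(x)]
    over the multiset of compositions [a] of [n + 1] reached from [[:: 1]] by
    [n] such moves. The multiplicity of [b] in this multiset is the sum of the
    multiplicities of its predecessors, and [C_b] satisfies the same
    recurrence: splitting off the last part of [b], it is Pascal's rule.
    The only composition of length [n + 1] contributes
    [[x,[...,[x,x]...]] = 0]. *)

Local Arguments all : simpl never.

Lemma all_cons (T : Type) (P : pred T) (x : T) (s : seq T) :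
  all P (x :: s) = P x && all P s.
Proof. by []. Qed.

(** * Moves between compositions and their inverses *)

Fixpoint incr_parts (a : seq nat) : seq (seq nat) :=
  if a is m :: s then (m.+1 :: s) :: map (cons m) (incr_parts s) else [::].

Fixpoint decr_parts (b : seq nat) : seq (seq nat) :=
  if b is m :: s
  then (if (1 < m)%N then [:: m.-1 :: s] else [::])
         ++ map (cons m) (decr_parts s)
  else [::].

Definition comp_succs (a : seq nat) : seq (seq nat) := (1%N :: a) :: incr_parts a.

Definition comp_preds (b : seq nat) : seq (seq nat) :=
  (if head 0%N b == 1%N then [:: behead b] else [::]) ++ decr_parts b.

Definition comp_walks (n : nat) : seq (seq nat) :=
  iter n (fun L => flatten (map comp_succs L)) [:: [:: 1%N]].

Lemma composition_size n a : is_composition n a -> (size a <= n)%N.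
Proof.
case/andP=> + /eqP <-; elim: a => [//|m s IH].
by rewrite all_cons => /andP [m1 /IH]; exact: (leq_add m1).
Qed.

Lemma incr_partsP n a c : is_composition n a -> c \in incr_parts a ->
  is_composition n.+1 c && (size c == size a).
Proof.
elim: a n c => [//|m s IH] n c; rewrite {1}/is_composition all_cons /=.
case/andP=> /andP [m1 s1] /eqP <-; rewrite inE => /orP [/eqP ->|/mapP [d ds ->]].
  by rewrite /is_composition all_cons s1 !eqxx.
have := IH (sumn s) d; rewrite /is_composition s1 eqxx => /(_ isT ds).
rewrite all_cons /= m1 => /andP [/andP [-> /eqP ->] /eqP ->].
by rewrite addnS !eqxx.
Qed.

Lemma decr_parts_composition n b c :
  is_composition n.+1 b -> c \in decr_parts b -> is_composition n c.
Proof.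
rewrite /is_composition => /andP [pb /eqP sb] cb.
suff /andP [-> /eqP] : all (leq 1) c && ((sumn c).+1 == sumn b).
  by rewrite sb => -[->]; rewrite eqxx.
elim: b {n sb} pb c cb => [//|m s IH]; rewrite all_cons /= => /andP [m1 s1] c.
rewrite mem_cat => /orP [|/mapP [d /(IH s1) /andP [pd /eqP <-] ->]].
  case: ifP => // m2; rewrite inE => /eqP ->; rewrite all_cons.
  by case: m m2 {m1} => [|[|m]] //= _; rewrite s1 eqxx.
by rewrite all_cons m1 pd /= addnS eqxx.
Qed.

Lemma comp_preds_composition n b c :
  is_composition n.+1 b -> c \in comp_preds b -> is_composition n c.
Proof.
move=> hb; rewrite mem_cat => /orP [|]; last exact: decr_parts_composition.
case: b hb => [|m s] //=; case: eqP => // -> /andP [+ /eqP [<-]].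
rewrite all_cons /= => s1.
by rewrite inE => /eqP ->; rewrite /is_composition s1 eqxx.
Qed.

Lemma count_mem_map_cons (m : nat) (s : seq nat) (S : seq (seq nat)) (n : nat) :
  count_mem (n :: s) (map (cons m) S) = ((m == n) * count_mem s S)%N.
Proof.
rewrite count_map; case: (eqVneq m n) => [->|mn].
  by rewrite mul1n; apply: eq_count => t /=; rewrite eqseq_cons eqxx.
by rewrite mul0n -(count_pred0 S); apply: eq_count => t /=;
  rewrite eqseq_cons (negPf mn).
Qed.

Lemma count_mem_nil_map_cons (m : nat) (S : seq (seq nat)) :
  count_mem [::] (map (cons m) S) = 0%N.
Proof. by rewrite count_map -(count_pred0 S); apply: eq_count. Qed.

(** Raising and lowering the same part are mutually inverse. Positivity of [a] matters, since
    [decr_parts] never lowers a part to 0. *)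
Lemma count_incr_decr a b : all (leq 1) a ->
  count_mem b (incr_parts a) = count_mem a (decr_parts b).
Proof.
elim: a b => [|m s IH] [|k t]; rewrite ?all_cons //=.
- by move=> _; rewrite count_cat count_mem_nil_map_cons; case: ifP.
- by move=> _; rewrite count_mem_nil_map_cons.
case/andP=> m1 s1; rewrite count_cat !count_mem_map_cons (IH _ s1) (eq_sym k m).
congr addn; rewrite eqseq_cons.
case: k => [|[|k]] //=; first by case: m m1.
by rewrite addn0 eqseq_cons eqSS (eq_sym k.+1) (eq_sym s).
Qed.

Lemma count_succs_preds a b : all (leq 1) a ->
  count_mem b (comp_succs a) = count_mem a (comp_preds b).
Proof.
move=> pa; rewrite /= count_cat count_incr_decr //; congr addn.
case: b => [|k t] //=; rewrite eqseq_cons (eq_sym 1%N) (eq_sym a).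
by case: (k == 1%N); rewrite //= addn0.
Qed.

(** * The recurrence for [comp_coef] *)

Lemma comp_coef_rcons s m :
  comp_coef (rcons s m) = (comp_coef s * 'C((sumn s + m).-1, m.-1))%N.
Proof.
rewrite /comp_coef size_rcons big_ord_recr /= take_oversize ?size_rcons //.
rewrite sumn_rcons nth_rcons ltnn eqxx; congr muln; apply: eq_bigr => i _.
by rewrite nth_rcons ltn_ord -cats1 take_cat ltn_neqAle;
  case: (ltngtP i.+1 (size s)) (ltn_ord i) => //= ->;
  rewrite subnn take0 cats0 take_size.
Qed.

Lemma decr_parts_rcons s m : decr_parts (rcons s m) =
  map (rcons^~ m) (decr_parts s)
    ++ (if (1 < m)%N then [:: rcons s m.-1] else [::]).
Proof.
elim: s => [|k s IH] /=; first by rewrite cats0.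
rewrite IH !map_cat -!map_comp catA; congr cat; last by case: ifP.
by case: ifP.
Qed.

(** As [s] is nonempty, a leading 1 to be removed lies in [s], so only lowering [m] touches the last
    part. *)
Lemma comp_preds_rcons (s : seq nat) (m : nat) : s != [::] -> comp_preds (rcons s m) =
  map (rcons^~ m) (comp_preds s)
    ++ (if (1 < m)%N then [:: rcons s m.-1] else [::]).
Proof.
case: s => [//|k s _]; rewrite /comp_preds decr_parts_rcons [in RHS]map_cat -catA.
by congr cat; rewrite /=; case: ifP.
Qed.

Lemma comp_coef_rec n b : is_composition n.+1 b ->
  comp_coef b = (\sum_(c <- comp_preds b) comp_coef c)%N.
Proof.
elim/last_ind: b n => [//|s m IH] n.
rewrite /is_composition all_rcons sumn_rcons => /andP [/andP [m1 s1] _].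
case: (eqVneq s [::]) => [->|s0].
  (* The only predecessor of [[:: m]] is [[:: m.-1]], or [[::]] if [m = 1]; all these coefficients
     are 1, the last as an empty product. *)
  case: m m1 => [|[|m]] //= _; rewrite /comp_preds /= big_seq1 /comp_coef /=;
    by rewrite !big_ord1 /= ?big_ord0 ?addn0 ?binn.
have [q qs] : exists q, sumn s = q.+1.
  by case: s s0 s1 {IH} => [//|[|k] s] //= _ _; exists (k + sumn s)%N.
have hs : is_composition q.+1 s by rewrite /is_composition s1 qs eqxx.
rewrite comp_preds_rcons // big_cat big_map /=.
rewrite (eq_big_seq (fun c => comp_coef c * 'C(q + m.-1, m.-1))%N); last first.
  move=> c /(comp_preds_composition hs) /andP [_ /eqP cq].
  by rewrite comp_coef_rcons cq; case: m m1 => //= m _; rewrite addnS.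
(* After division by [comp_coef s], changing [s] contributes ['C(q + m - 1, m - 1)] and lowering
   [m > 1] contributes ['C(q + m - 1, m - 2)]; Pascal's rule adds them up to ['C(q + m, m - 1)]. *)
rewrite -big_distrl -(IH q) //= comp_coef_rcons qs addSn /=.
case: m m1 => [|[|m]] //= _; first by rewrite big_nil !addn0 !bin0.
by rewrite big_seq1 comp_coef_rcons qs addnS binS mulnDr addSn /= addnS.
Qed.

(** * Multiplicities of the endpoints of walks *)

Lemma count_sum (T : Type) (P : pred T) (s : seq T) :
  count P s = (\sum_(i <- s) P i)%N.
Proof. by rewrite -sumn_count sumnE big_map. Qed.

Lemma sum_count_memC (T : eqType) (L M : seq T) :
  (\sum_(a <- L) count_mem a M = \sum_(c <- M) count_mem c L)%N.
Proof.
under eq_bigr do rewrite count_sum.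
rewrite exchange_big /=; apply: eq_bigr => c _; rewrite count_sum.
by apply: eq_bigr => a _; rewrite /= eq_sym.
Qed.

Lemma comp_walks_composition n a : a \in comp_walks n -> is_composition n.+1 a.
Proof.
elim: n a => [|n IH] a; first by rewrite inE => /eqP ->.
move=> /flatten_mapP [b /IH hb]; rewrite inE => /orP [/eqP ->|].
  by move: hb; rewrite /is_composition all_cons /= => /andP [-> /eqP ->]; rewrite eqxx.
by case/(incr_partsP hb)/andP.
Qed.

(** Reading the last move backwards and double counting turns the multiplicity of [b] into the sum
    of those of its predecessors, which is the recurrence [comp_coef_rec]. *)
Lemma count_comp_walks n b :
  is_composition n.+1 b -> count_mem b (comp_walks n) = comp_coef b.
Proof.
elim: n b => [|n IH] b hb.
  case: b hb (composition_size hb) => [//|m [|//]] /andP [_ /eqP].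
  by rewrite /= addn0 => -> _; rewrite /comp_coef big_ord1.
rewrite (comp_coef_rec hb) /= count_flatten -map_comp sumnE big_map.
rewrite (eq_big_seq (fun a => count_mem a (comp_preds b))); last first.
  move=> a /comp_walks_composition /andP [pa _] /=.
  exact: count_succs_preds.
rewrite sum_count_memC; apply: eq_big_seq => c.
by move/(comp_preds_composition hb)/IH.
Qed.

(** * From lists of walks to sums over tuples *)

Lemma composition_bound n a : is_composition n a -> all (leq^~ n) a.
Proof.
case/andP=> _ /eqP <-; apply/allP => m; elim: a => [//|j s IH] /=.
rewrite inE => /orP [/eqP ->|/IH le_ms]; first exact: leq_addr.
exact: leq_trans le_ms (leq_addl _ _).
Qed.

(** Exactly one pair [(i, t)] represents [a]: its size and the tuple of its parts, which [inord]
    preserves because they are at most [n + 1]. *)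
Lemma sum_tuple_eq (V : nmodType) (F : seq nat -> V) (n : nat) (a : seq nat) :
  is_composition n.+1 a ->
  \sum_(1 <= i < n.+2)
    \sum_(t : i.-tuple 'I_n.+2 | is_composition n.+1 (map val t))
      F (map val t) *+ (a == map val t) = F a.
Proof.
move=> ha; have [sz_gt0 sz_le] : (0 < size a)%N /\ (size a <= n.+1)%N.
  by split; [case: a ha | exact: composition_size ha].
have va : map val (map (@inord n.+1) a) = a.
  rewrite -map_comp -[RHS]map_id; apply/eq_in_map => m.
  by move/(allP (composition_bound ha)) => le_m /=; rewrite inordK.
rewrite (bigD1_seq (size a)) ?iota_uniq //=; last by rewrite mem_index_iota sz_gt0.
rewrite [X in _ + X]big1 ?addr0 => [|i ia]; last first.
  apply: big1 => t _; case: eqP => // at_; move: ia.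
  by rewrite at_ size_map size_tuple eqxx.
have sz : size (map (@inord n.+1) a) == size a by rewrite size_map.
rewrite (bigD1 (Tuple sz)) /= va // eqxx mulr1n big1 ?addr0 // => t /andP [_ nt].
case: eqP => // at_; case/eqP: nt; apply/val_inj/(inj_map val_inj).
by rewrite /= va.
Qed.

Lemma sum_comp_walks (V : nmodType) (F : seq nat -> V) (n : nat) :
  \sum_(a <- comp_walks n) F a =
  \sum_(1 <= i < n.+2)
    \sum_(t : i.-tuple 'I_n.+2 | is_composition n.+1 (map val t))
      F (map val t) *+ comp_coef (map val t).
Proof.
rewrite (eq_big_seq (fun a => \sum_(1 <= i < n.+2)
    \sum_(t : i.-tuple 'I_n.+2 | is_composition n.+1 (map val t))
      F (map val t) *+ (a == map val t))); last first.
  by move=> a /comp_walks_composition ha; rewrite sum_tuple_eq.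
rewrite exchange_big; apply: eq_bigr => i _ /=.
rewrite exchange_big; apply: eq_bigr => t ht /=.
by rewrite -(count_comp_walks ht) count_sum sumrMnr.
Qed.

(** * Iterated brackets along walks *)

Section LieIteration.

Variables (R : comPzRingType) (g : lieAlgType R).
Implicit Types (x y : g) (D : {linear g -> g}).

HB.instance Definition _ x := GRing.isLinear.Build R g g _ (lie x) (lie_linearr x).

Lemma derivation_comp_lie D x a : derivation D -> all (leq 1) a ->
  D (comp_lie D x a) = \sum_(c <- incr_parts a) comp_lie D x c.
Proof.
move=> hD; elim: a => [|m [|j s] IH]; first by rewrite big_nil linear0.
  by case: m => [//|m] _; rewrite big_seq1.
have -> : incr_parts [:: m, j & s] =
    [:: m.+1, j & s] :: map (cons m) (incr_parts (j :: s)) by [].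
rewrite all_cons => /andP [m1 ps].
have -> : comp_lie D x [:: m, j & s] =
    lie (iter m.-1 D x) (comp_lie D x (j :: s)) by [].
rewrite big_cons big_map hD (IH ps); congr (_ + _).
  by case: m m1.
(* Every member [c] of [incr_parts (j :: s)] is nonempty, so [comp_lie] of [m :: c] is a bracket and
   not the one-part case. *)
rewrite linear_sum; apply: eq_big_seq => c.
by rewrite [_ \in _]/= => /orP [/eqP ->|/mapP [d _ ->]].
Qed.

Lemma comp_lie_nseq1 D x n : comp_lie D x (nseq n.+2 1%N) = 0.
Proof.
elim: n => [|n IH]; first exact: liexx.
have -> : comp_lie D x (nseq n.+3 1%N) = lie x (comp_lie D x (nseq n.+2 1%N)) by [].
by rewrite IH linear0.
Qed.

Lemma iter_ad_derivation D lambda x n : derivation D ->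
  iter n (fun y => lambda *: ad x y + D y) x =
  \sum_(a <- comp_walks n) lambda ^+ (size a).-1 *: comp_lie D x a.
Proof.
move=> hD; elim: n => [|n IH]; first by rewrite big_seq1 scale1r.
rewrite [LHS]/= {}IH /ad !linear_sum /= -big_split big_flatten big_map /=.
apply: eq_big_seq => a /comp_walks_composition ha.
have /andP [pa _] := ha.
rewrite big_cons /= !linearZ /= derivation_comp_lie // scaler_sumr; congr (_ + _).
  (* Since [a] is nonempty, prepending 1 raises the exponent [(size a).-1] by exactly one. *)
  by case: a ha {pa} => [//|m s] _; rewrite scalerA -exprSr.
by apply: eq_big_seq => c /(incr_partsP ha)/andP [_ /eqP ->].
Qed.

End LieIteration.

Lemma composition_size_eq n a :
  is_composition n a -> size a = n -> a = nseq n 1%N.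
Proof.
elim: a n => [|m s IH] n; first by move=> _ <-.
rewrite {1}/is_composition all_cons => /andP [/andP [m1 s1] /eqP <-] {n} /=.
have hs : is_composition (sumn s) s by rewrite /is_composition s1 eqxx.
have les := composition_size hs.
case: m m1 => [//|[|m]] _; first by case=> /(IH _ hs) {1}->.
(* A first part of at least 2 would leave [s] longer than its sum. *)
by move=> e; move: les; rewrite -ltnS e addSn ltnS addSn ltnNge leq_addl.
Qed.

(* Parts of a composition of n + 1 are at most n + 1, so compositions of length
   i are exactly the tuples in 'I_n.+2 satisfying is_composition n.+1. *)
Theorem lemma4p6 (k : closedFieldType) (p : nat) (hp : p \in [pchar k])
    (g : lieAlgType k) (D : {linear g -> g}) (hD : derivation D)
    (lambda : k) (x : g) (n : nat) (hn : (1 <= n <= p.-1)%N) :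
  iter n (fun y : g => lambda *: ad x y + D y) x =
  \sum_(1 <= i < n.+1) lambda ^+ i.-1 *:
    \sum_(a : i.-tuple 'I_n.+2 | is_composition n.+1 (map val a))
      comp_lie D x (map val a) *+ comp_coef (map val a).
Proof.
case: n hn => [//|n] _; rewrite iter_ad_derivation // sum_comp_walks.
(* The walks also reach the all-ones composition, one longer than the lengths in the goal. As the
   number of iterations is positive, it has at least two parts and its bracket vanishes. *)
rewrite big_nat_recr //= [X in _ + X]big1 ?addr0 => [|t ht]; last first.
  rewrite (composition_size_eq ht) ?size_map ?size_tuple //.
  by rewrite comp_lie_nseq1 scaler0 mul0rn.
apply: eq_bigr => i _; rewrite scaler_sumr; apply: eq_bigr => t _.
by rewrite size_map size_tuple scalerMnr.
Qed.
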